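(* For every $X\subseteq 2^\omega$ the following are equivalent: (1) $\mathcal{F}_X$ is rapid; (2) for every partitioning real $d$, $X$ goes through some $d$-binary slalom; (3) for every partitioning real $d$, the set $\mathrm{nat}_d[X]=\{\mathrm{nat}_d(x):x\in X\}\subseteq\omega^\omega$ goes through some slalom.
   Context: Subsets of $\omega$ are identified with elements of $2^\omega$; a natural number $n$ is identified with $\{0,\dots,n-1\}$. For distinct $x,y\in 2^\omega$ let $h(x,y)=\min\{n:x(n)\neq y(n)\}$; for $X\subseteq 2^\omega$ let $H(X)=\{h(x,y):x,y\in X, x\neq y\}$. The Raisonnier filter $\mathcal{F}_X$ is the set of all $a\subseteq\omega$ for which there is a countable family $\{Y_n:n<\omega\}$ of subsets of $2^\omega$ with $X\subseteq\bigcup_nY_n$ and $a\supseteq\bigcup_nH(Y_n)$. A filter $\mathcal{F}$ on $\omega$ (the trivial filter $\mathcal{P}(\omega)$ included) is rapid if for every increasing $f\in\omega^\omega$ there is $a\in\mathcal{F}$ with $|a\cap f(n)|\le n$ for all $n$. A partitioning real is a strictly increasing $d\in\omega^\omega$ with $d(0)=0$; write $I^d_n=[d(n),d(n+1))$. A $d$-binary slalom is a function $B$ on $\omega$ such that for each $n$, $B(n)\subseteq\{0,1\}^{|I^d_n|}$ and $|B(n)|\le n$; $x\in 2^\omega$ goes through $B$ if $x\restriction I^d_n\in B(n)$ for all but finitely many $n$, and $X$ goes through $B$ if every $x\in X$ does. A slalom is a function $S:\omega\to[\omega]^{<\omega}$ with $|S(n)|\le n$ for all $n$; $f\in\omega^\omega$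 goes through $S$ if $f(n)\in S(n)$ for all but finitely many $n$, and a set goes through $S$ if each of its elements does. $\mathrm{nat}:2^{<\omega}\to\omega$ maps a finite binary sequence to the natural number it represents in binary, and $\mathrm{nat}_d(x)(n)=\mathrm{nat}(x\restriction I^d_n)$ for $x\in 2^\omega$. *)

(* Defs.v *)
From mathcomp Require Import all_boot finmap.
From mathcomp Require Import boolp classical_sets functions cardinality filter.

Set Implicit Arguments.
Unset Strict Implicit.
Unset Printing Implicit Defensive.

Local Open Scope classical_set_scope.
Local Open Scope card_scope.

Definition cantor_seq := nat -> bool.

Lemma neq_cantor_seq (x y : cantor_seq) : x <> y -> exists n, x n != y n.
Proof.
move=> xy; apply: contrapT => /forallNP eqxy; apply: xy.
by apply/funext => n; apply/eqP/negPn/negP/eqxy.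
Qed.

Definition h (x y : cantor_seq) (xy : x <> y) : nat :=
  ex_minn (neq_cantor_seq xy).

Definition H (X : set cantor_seq) : set nat :=
  [set n | exists x y (xy : x <> y), [/\ X x, X y & n = h xy]].

Definition raisonnier (X : set cantor_seq) : set_system nat :=
  [set a | exists Y : nat -> set cantor_seq,
     X `<=` \bigcup_n Y n /\ \bigcup_n H (Y n) `<=` a].

Lemma H_sub (X Y : set cantor_seq) : X `<=` Y -> H X `<=` H Y.
Proof.
move=> XY n [x [y [xy [Xx Xy ->]]]].
by exists x, y, xy; split => //; apply: XY.
Qed.

#[global]
Instance raisonnier_filter (X : set cantor_seq) : Filter (raisonnier X).
Proof.
split.
- by exists (fun=> X); split => // x Xx; exists 0.
- move=> a b [Y [XY Ya]] [Z [XZ Zb]].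
  pose dec (n : nat) : nat * nat := odflt (0, 0) (choice.unpickle n).
  exists (fun n => Y (dec n).1 `&` Z (dec n).2); split.
    move=> x Xx; have [i _ Yx] := XY _ Xx; have [j _ Zx] := XZ _ Xx.
    by exists (choice.pickle (i, j)) => //; rewrite /dec choice.pickleK.
  move=> k [n _ Hk]; split.
    by apply: Ya; exists (dec n).1 => //; apply: H_sub Hk => x [].
  by apply: Zb; exists (dec n).2 => //; apply: H_sub Hk => x [].
- by move=> a b ab [Y [XY Ya]]; exists Y; split=> //; apply: subset_trans ab.
Qed.

(* "Increasing" is taken in the weak sense. Replacing f by n |-> f n + n shows
   that quantifying over strictly increasing f gives the same notion. *)
Definition rapid (F : set_system nat) : Prop :=
  forall f : nat -> nat, {homo f : m n / m <= n} ->
    exists2 a, F a & forall n, a `&` `I_(f n) #<= `I_n.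

Definition partitioning (d : nat -> nat) : Prop :=
  d 0 = 0 /\ {homo d : m n / m < n}.

Definition ilen (d : nat -> nat) (n : nat) : nat := d n.+1 - d n.

(* The restriction of x to [d n, d n.+1), shifted to start at 0. *)
Definition restr (d : nat -> nat) (x : cantor_seq) (n : nat) :
  (ilen d n).-tuple bool := [tuple x (d n + i) | i < ilen d n].

Definition bslalom (d : nat -> nat)
    (B : forall n, {set (ilen d n).-tuple bool}) : Prop :=
  forall n, #|B n| <= n.

Definition goes_through_bslalom (d : nat -> nat)
    (B : forall n, {set (ilen d n).-tuple bool}) (X : set cantor_seq) : Prop :=
  forall x, X x -> \forall n \near \oo, restr d x n \in B n.

Definition slalom (S : nat -> {fset nat}) : Prop := forall n, #|` S n| <= n.

Definition goes_through_slalom (S : nat -> {fset nat}) (A : set (nat -> nat)) :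
  Prop := forall f, A f -> \forall n \near \oo, f n \in S n.

(* The most significant bit comes first. *)
Definition nat_of_bits (s : seq bool) : nat :=
  foldl (fun (m : nat) (b : bool) => m.*2 + b) 0 s.

Definition nat_d (d : nat -> nat) (x : cantor_seq) (n : nat) : nat :=
  nat_of_bits (restr d x n).

(* Main.v *)
(* (1) => (2): if a contains H(Y_k) for all k, then an element of Y_k is
   determined up to level N by its trace on a `&` `I_N.  Rapidity applied to
   f(j) = d(4^(j+1)) leaves at most 2^j traces below d(n+1) when
   4^j <= n < 4^(j+1), so the first 2^j sets Y_k together give at most
   4^j <= n restrictions to the n-th interval.
   (3) => (2): nat_of_bits is injective on words of a given length.
   (2) => (1): take d(i) = f(8^i) + i for i > 0.  Splitting X according to the
   level m from which x follows B and to x below d(m) gives countably many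
   sets, whose splitting levels are first differences of two words of the same
   B(n).  Below d(j+1) there are at most 1^2 + ... + j^2 <= 8^j of these. *)
Require Import Defs.
From mathcomp Require Import all_boot finmap.
From mathcomp Require Import boolp classical_sets functions cardinality filter.

Set Implicit Arguments.
Unset Strict Implicit.
Unset Printing Implicit Defensive.

Local Open Scope classical_set_scope.

(** * Cardinality bounds for finite sets *)

Section Counting.
Local Open Scope card_scope.

Lemma card_le_seq (T : eqType) (A : set T) (s : seq T) (n : nat) :
  (forall x, A x -> x \in s) -> size s <= n -> A #<= `I_n.
Proof.
move=> As sn.
apply/pcard_leP/injfunPex; exists (fun x => index x s).
  by move=> x /As xs; apply: leq_trans sn; rewrite /= index_mem.
move=> x y; rewrite !inE => /As xs /As ys exy.
by rewrite -(nth_index x xs) exy nth_index.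
Qed.

Lemma card_ord_le (A : set nat) (N n : nat) :
  A `&` `I_N #<= `I_n -> #|[set i : 'I_N | `[< A i >]]%SET| <= n.
Proof.
set E := finset _ => leAn; rewrite -card_le_II; apply: card_le_trans leAn.
(* The enumeration below uses [ord0] as default, so ['I_N] must be inhabited. *)
case: N @E => [|N] E.
  by rewrite (eq_card0 (A := E)) ?II0 ?card_ge0 // => -[].
apply/pcard_leP/injfunPex.
exists (fun i => nth ord0 (enum E) i : nat) => [i /= iE|i j].
  have : nth ord0 (enum E) i \in E by rewrite -mem_enum mem_nth // -cardE.
  by rewrite /E inE => /asboolP Ai; split.
rewrite !inE /= => iE jE /val_inj /eqP.
by rewrite nth_uniq -?cardE ?enum_uniq // => /eqP.
Qed.

End Counting.

(** * First differences, words on intervals and their binary values *)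

Section FirstDifference.
Variables (x y : cantor_seq) (xy : x <> y).

Lemma h_neq : x (h xy) != y (h xy).
Proof. by rewrite /h; case: ex_minnP. Qed.

Lemma h_min (n : nat) : x n != y n -> h xy <= n.
Proof. by rewrite /h; case: ex_minnP => m _; apply. Qed.

Lemma eq_below_h (n : nat) : n < h xy -> x n = y n.
Proof. by move=> nh; apply/eqP/negPn/negP => /h_min; rewrite leqNgt nh. Qed.

End FirstDifference.

Lemma restr_eqP (d : nat -> nat) (x y : cantor_seq) (n : nat) :
  {homo d : m n / m < n} ->
  reflect (forall i, d n <= i < d n.+1 -> x i = y i)
          (restr d x n == restr d y n).
Proof.
move=> dhomo; have dn := ltnW (dhomo _ _ (ltnSn n)).
apply: (iffP eqP) => [exy i /andP[di id]|exy].
  have ilt : i - d n < ilen d n by rewrite ltn_sub2r ?(leq_ltn_trans di id).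
  have := congr1 (fun t => tnth t (Ordinal ilt)) exy.
  by rewrite !tnth_mktuple /= subnKC.
apply: eq_from_tnth => i; rewrite !tnth_mktuple; apply: exy.
by rewrite leq_addr /= -ltn_subRL ltn_ord.
Qed.

Lemma nat_of_bits_inj (n : nat) :
  injective (fun t : n.-tuple bool => nat_of_bits t).
Proof.
(* The accumulators vary so that induction passes to the tails, where it gives
   [k.*2 + b = l.*2 + c]; parity then separates the bits from the accumulators. *)
have foldl_inj s t k l : size s = size t ->
    foldl (fun (m : nat) (b : bool) => m.*2 + b) k s =
    foldl (fun (m : nat) (b : bool) => m.*2 + b) l t -> k = l /\ s = t.
  elim: s t k l => [|b s IHs] [|c t] //= k l [] sz.
  move=> /(IHs _ _ _ sz)[ekl ->].
  have ebc : b = c by move: (congr1 odd ekl); rewrite !oddD !odd_double !oddb.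
  by move: ekl; rewrite ebc => /addIn/double_inj->.
move=> s t /foldl_inj; rewrite !size_tuple => /(_ erefl)[_ est].
exact: val_inj.
Qed.

Lemma partitioning_block (d : nat -> nat) (n : nat) : partitioning d ->
  exists k, d k <= n < d k.+1.
Proof.
move=> [d0 dhomo]; elim: n => [|n [k /andP[dk nd]]].
  by exists 0; have := dhomo 0 1 isT; rewrite d0.
case: (ltnP n.+1 (d k.+1)) => [ltd|led]; first by exists k; rewrite ltd leqW.
by exists k.+1; rewrite led (leq_ltn_trans nd) // dhomo.
Qed.

Lemma partitioning_mono (d : nat -> nat) :
  partitioning d -> {mono d : m n / m <= n}.
Proof. by move=> [_ dhomo]; apply: leq_mono. Qed.

(** * From rapidity to binary slaloms *)

Lemma rapid_bslalom (X : set cantor_seq) (d : nat -> nat) :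
  rapid (raisonnier X) -> partitioning d ->
  exists2 B : forall n, {set (ilen d n).-tuple bool},
    bslalom B & goes_through_bslalom B X.
Proof.
move=> rX pd; have dmono := partitioning_mono pd; case: (pd) => [_ dhomo].
have [|a [Y [XY Ya]] acard] := rX (fun j => d (4 ^ j.+1)).
  by move=> i j ij; rewrite dmono leq_exp2l.
pose A n : {set 'I_(d n.+1)} := [set i : 'I_(d n.+1) | `[< a i >]]%SET.
pose tr n (x : cantor_seq) : {set 'I_(d n.+1)} := [set i in A n | x i]%SET.
pose j n := trunc_log 4 n.
(* One representative per trace; when no member of [Y k] has trace [P], the default only adds a
   harmless word to [B n]. *)
pose z n k P := xget (fun=> false) [set x | Y k x /\ tr n x = P].
pose B n := if n is 0 then finset.set0 else
  [set restr d (z n (val p.1) p.2) n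
     | p in finset.setX [set: 'I_(2 ^ j n)] (powerset (A n))]%SET.
exists B.
  case=> [|n]; first by rewrite cards0.
  apply: leq_trans (leq_imset_card _ _) _.
  rewrite cardsX cardsT card_ord card_powerset.
  apply: leq_trans (_ : 2 ^ j n.+1 * 2 ^ j n.+1 <= _).
    rewrite leq_mul2l leq_exp2l ?card_ord_le ?orbT //.
    apply: card_le_trans (acard (j n.+1)); apply: subset_card_le => i [ai id].
    split=> //=; apply: leq_trans id _.
    by rewrite dmono; apply: trunc_log_ltn.
  by rewrite -expnMn; apply: trunc_logP.
(* From [4 ^ k] on, [k <= j n], hence [k < 2 ^ k <= 2 ^ j n] and [Y k] is among the sets counted. *)
move=> x /XY[k _ Ykx]; exists (4 ^ k) => // -[|n] /= kn.
  by move: kn; rewrite leqn0 expn_eq0.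
have kj : k < 2 ^ j n.+1.
  apply: leq_trans (ltn_expl k (isT : 1 < 2)) _.
  by rewrite leq_exp2l ?trunc_log_max.
apply/imsetP; exists (Ordinal kj, tr n.+1 x).
  by rewrite !inE /=; apply/fintype.subsetP => i; rewrite inE => /andP[].
have [Ykz etr] : Y k (z n.+1 k (tr n.+1 x)) /\
    tr n.+1 (z n.+1 k (tr n.+1 x)) = tr n.+1 x.
  by rewrite /z; case: xgetP => [_ -> //|/(_ x)[]].
move: (z _ _ _) Ykz etr => /= y Yky etr.
apply/eqP/(restr_eqP _ _ _ dhomo) => i /andP[_ id]; apply/eqP/negPn/negP => nxy.
have xy : x <> y by move=> exy; rewrite exy eqxx in nxy.
(* The first difference may precede the interval; it still lies in [a] below [d n.+2], where equal
   traces force equal values. *)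
have hd : h xy < d n.+2 by apply: leq_ltn_trans id; apply: h_min.
have ah : a (h xy) by apply: Ya; exists k => //; exists x, y, xy.
have := h_neq xy; move/setP/(_ (Ordinal hd)): etr.
by rewrite !inE /= (asboolT ah) /= => ->; rewrite eqxx.
Qed.

(** * From binary slaloms to rapidity *)

Lemma bslalom_rapid (X : set cantor_seq) :
  (forall d : nat -> nat, partitioning d ->
     exists2 B : forall n, {set (ilen d n).-tuple bool},
       bslalom B & goes_through_bslalom B X) ->
  rapid (raisonnier X).
Proof.
move=> slX f fhomo.
(* The summand [i] gives strictness, as [f] is only weakly increasing. *)
pose d i := if i is 0 then 0 else f (8 ^ i) + i.
have dhomo : {homo d : m n / m < n}.
  case=> [|m] [|n] //= mn; first by rewrite addnS.
  by rewrite -addnS leq_add // fhomo // leq_exp2l // ltnW.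
have pd : partitioning d by split.
have dmono := partitioning_mono pd.
have [B Bn XB] := slX d pd.
(* For [s = t] this is [d n.+1], a spurious value that still respects [D_ge] and is included in the
   count [n ^ 2]. *)
pose fd n (s t : (ilen d n).-tuple bool) :=
  d n + find (fun i => nth false s i != nth false t i) (iota 0 (ilen d n)).
pose D n := [seq fd n s t | s <- enum (B n), t <- enum (B n)].
have D_ge n i : i \in D n -> d n <= i.
  by move=> /allpairsP[p [_ _ ->]]; apply: leq_addr.
have size_D n : size (D n) <= n ^ 2.
  by rewrite size_allpairs -!cardE -mulnn leq_mul ?Bn.
have h_D n x y (xy : x <> y) : restr d x n \in B n -> restr d y n \in B n ->
    d n <= h xy < d n.+1 -> h xy \in D n.
  move=> Bx By /andP[dh hd]; apply/allpairsP.
  exists (restr d x n, restr d y n); split; rewrite ?mem_enum // /fd /=.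
  have ilt : h xy - d n < ilen d n.
    by rewrite ltn_sub2r ?(leq_ltn_trans dh hd).
  have nth_restr w k (kl : k < ilen d n) :
      nth false (restr d w n) k = w (d n + k).
    by rewrite -(tnth_nth _ _ (Ordinal kl)) tnth_mktuple.
  rewrite -[LHS](subnKC dh); congr addn.
  case: findP => [/hasPn /(_ (h xy - d n))|k].
    rewrite mem_iota add0n leq0n /= => /(_ ilt).
    by rewrite !nth_restr // subnKC // h_neq.
  rewrite size_iota => kl /(_ 0); rewrite nth_iota // add0n !nth_restr // => dk.
  move=> /(_ 0) kmin; apply/eqP; rewrite eqn_leq leq_subLR h_min //= leqNgt.
  apply/negP => ltk; move: (kmin _ ltk).
  by rewrite nth_iota // add0n !nth_restr // subnKC // h_neq.
exists [set i | exists n, i \in D n].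
  pose dec i : nat * seq bool := odflt (0, [::]) (choice.unpickle i).
  exists (fun i => [set x | mkseq x (d (dec i).1) = (dec i).2 /\
    forall n, (dec i).1 <= n -> restr d x n \in B n]); split.
    move=> x /XB[m _ mB].
    exists (choice.pickle (m, mkseq x (d m))) => //.
    by rewrite /dec choice.pickleK.
  move=> _ [i _ [x [y [xy [[ex Bx] [ey By] ->]]]]].
  have [n hn] := partitioning_block (h xy) pd.
  (* Two members of one piece share their prefix below [d (dec i).1], so they first differ in an
     interval where both already follow [B]. *)
  have mn : (dec i).1 <= n.
    rewrite leqNgt; apply/negP => nm; have := h_neq xy; apply/negP/negPn/eqP.
    have hm : h xy < d (dec i).1.
      by apply: leq_trans (_ : d n.+1 <= _); rewrite ?dmono //; case/andP: hn.
    rewrite -(nth_mkseq false x hm) -(nth_mkseq false y hm).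
    by rewrite ex ey.
  by exists n; apply: h_D; [apply: Bx | apply: By | ].
move=> n; pose j := trunc_log 8 n.
apply: (@card_le_seq _ _ (flatten [seq D k | k <- iota 0 j.+1])).
  move=> i [[k iD] lti].
  (* If [k > j], all of [D k] is at least [d j.+1 >= f (8 ^ j.+1) >= f n]. *)
  apply/flatten_mapP; exists k => //; rewrite mem_iota /= add0n.
  rewrite ltnNge; apply/negP => jk; have := D_ge _ _ iD; apply/negP.
  rewrite -ltnNge; apply: leq_trans (_ : d j.+1 <= d k); last by rewrite dmono.
  apply: leq_trans lti _; apply: leq_trans (leq_addr _ _).
  by apply: fhomo; apply/ltnW/trunc_log_ltn.
have size_flat m : size (flatten [seq D k | k <- iota 0 m.+1]) <= m ^ 3.
  elim: m => [|m IHm]; first by rewrite /= cats0 (size_D 0).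
  rewrite -addn1 iotaD map_cat flatten_cat size_cat /= cats0 add0n.
  apply: leq_trans (leq_add IHm (size_D _)) _.
  rewrite [leqRHS]expnS mulSn addnC leq_add2l expnS leq_mul2l leq_exp2r //.
  by rewrite leqnSn orbT.
apply: leq_trans (size_flat _) _; rewrite /j.
(* For [n = 0] the logarithm is 0 and so is the bound; otherwise [j ^ 3 <= (2 ^ j) ^ 3 = 8 ^ j]. *)
case: n @j => [//|n]; apply: leq_trans (trunc_logP (isT : 1 < 8) (ltn0Sn n)).
by rewrite (_ : 8 = 2 ^ 3) // expnAC leq_exp2r // ltnW // ltn_expl.
Qed.

Theorem theorem4p9 (X : set cantor_seq) :
  [<-> rapid (raisonnier X);
       forall d : nat -> nat, partitioning d ->
         exists2 B : forall n, {set (ilen d n).-tuple bool},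
           bslalom B & goes_through_bslalom B X;
       forall d : nat -> nat, partitioning d ->
         exists2 S : nat -> {fset nat},
           slalom S & goes_through_slalom S (nat_d d @` X)].
Proof.
tfae.
- by move=> rX d; apply: rapid_bslalom.
- move=> slX d /slX[B Bn XB].
  exists (fun n => [fset nat_of_bits (val t) | t in B n])%fset.
    by move=> n; apply: leq_trans (leq_imfset_card _ _ _) _;
       rewrite -cardE; apply: Bn.
  move=> _ [x /XB[m _ mB] <-]; exists m => // n /mB xB.
  by apply/imfsetP; exists (restr d x n).
move=> slX; apply: bslalom_rapid => d /slX[S Sn XS].
exists (fun n => [set t | nat_of_bits (val t) \in S n]%SET).
  move=> n; apply: leq_trans (Sn n).
  rewrite cardE -(size_map (fun t : (ilen d n).-tuple bool => nat_of_bits t)).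
  apply: uniq_leq_size; first
    by rewrite (map_inj_uniq (@nat_of_bits_inj _)) enum_uniq.
  by move=> _ /mapP[t + ->]; rewrite mem_enum inE.
move=> x Xx; have [m _ mS] := XS (nat_d d x) (imageP _ Xx).
by exists m => // n /mS; rewrite /= inE.
Qed.
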